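(* Let $D$ be a digraph. The topological space $|D|$ (with the topology DTop) is compact if and only if $D$ is solid.
   Context: Digraphs have no loops and no parallel edges; an edge is an ordered pair $vw$ with tail $v$ and head $w$. For a digraph $D$ let $\mathcal{X}(D)$ be the set of finite subsets of $V(D)$. $D$ is called solid if $D-X$ has only finitely many strong components for every $X\in\mathcal{X}(D)$. A ray is a one-way infinite directed path $v_0v_1v_2\dots$ (edges $v_iv_{i+1}$); its tails are its subrays. A ray is solid in $D$ if for every $X\in\mathcal{X}(D)$ it has a tail in some strong component of $D-X$. Two solid rays are equivalent if for every $X\in\mathcal{X}(D)$ they have tails in the same strong component of $D-X$; the equivalence classes are the ends of $D$, forming the set $\Omega(D)$. For an end $\omega$ and $X\in\mathcal{X}(D)$, $C(X,\omega)$ is the strong component of $D-X$ containing tails of the rays in $\omega$; we say $\omega$ lives in $C(X,\omega)$. $X$ separates ends $\omega,\eta$ if $C(X,\omega)\neq C(X,\eta)$. Limit edges: for distinct ends $\omega,\eta$, the pair $(\omega,\eta)$ is a limit edge (tail $\omega$, head $\eta$) if for every $X\in\mathcal{X}(D)$ separating $\omega$ and $\eta$, $D$ has an edge from $C(X,\omega)$ to $C(X,\eta)$. For a vertex $v$ and an end $\omega$, $(v,\omega)$ is a limit edge if $D$ has an edge from $v$ to $C(X,\omega)$ for every $X\in\mathcal{X}(D)$ with $v\notin C(X,\omega)$; $(\omega,v)$ is a limit edge if $D$ has an edge from $C(X,\omega)$ to $v$ for every such $X$. $\Lambda(D)$ is the set of limit edges. The space $|D|$: take $V(D)\cup\Omega(D)$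 and a copy $[0,1]_e$ of the unit interval for each $e\in E(D)\cup\Lambda(D)$, and identify the tail of $e$ with $0\in[0,1]_e$ and the head of $e$ with $1\in[0,1]_e$. The image of $[0,1]_e$ is an edge of $|D|$; points other than its endpoints are inner points. Inner points of two edges correspond if they come from the same real number. Given $X\in\mathcal{X}(D)$ and a strong component $C$ of $D-X$: a limit edge lives in $C$ if each of its endpoints is a vertex of $C$ or an end living in $C$. The topology DTop is generated by the following basic open sets ($0<\varepsilon<1$, always small enough to fit in the relevant edges): (1) for a vertex $v$: the open star consisting of $v$ together with $[0,\varepsilon)$ of every edge of $|D|$ with tail $v$ and $(1-\varepsilon,1]$ of every edge of $|D|$ with head $v$; (2) for an inner point $z$ of an edge $e\in E(D)$: open subintervals of the interior of $e$ containing $z$; (3) for an end $\omega$ and $X\in\mathcal{X}(D)$: the set $\hat C_\varepsilon(X,\omega)$, the union of the vertices and inner points of edges of $C(X,\omega)$, all ends living in $C(X,\omega)$, all points of limit edges living in $C(X,\omega)$, and, for every edge $e\in E(D)\cup\Lambda(D)$ having exactly one endpoint $y$ that is a vertex of or an end living in $C(X,\omega)$, the half-open segment of $e$ of length $\varepsilon$ at $y$ (including $y$); (4) for an inner point $z$ of a limit edge $(\omega,\eta)$ between ends and $X\in\mathcal{X}(D)$ separating $\omega,\eta$: the set $\hat E_{\varepsilon,z}(X,\omega\eta)$, the union of the open intervals of radius $\varepsilon$ around the points corresponding to $z$ on all edges of $D$ from $C(X,\omega)$ to $C(X,\eta)$ and on all limit edges whose tail is a vertex of or an end living in $C(X,\omega)$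 and whose head is a vertex of or an end living in $C(X,\eta)$; for an inner point $z$ of a limit edge $(v,\omega)$ and $X\in\mathcal{X}(D)$ with $v\in X$: the analogous union over all edges of $D$ from $v$ to $C(X,\omega)$ and all limit edges $(v,\omega')$ with $\omega'$ living in $C(X,\omega)$; and symmetrically for limit edges $(\omega,v)$. *)

(* Defs.v *)
From HB Require Import structures.
From Stdlib Require Import List Relations Reals.
From mathcomp Require Import all_boot.
From mathcomp Require Import all_classical.
From mathcomp Require Import topology.

Set Implicit Arguments.
Unset Strict Implicit.
Unset Printing Implicit Defensive.

Local Open Scope R_scope.

(** A digraph is a vertex type [V] with an edge relation [E : V -> V -> Prop]
    (so there are no parallel edges); "no loops" is a hypothesis of the
    theorem.  Finite subsets of [V] are represented by lists. *)

Section DigraphSpace.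
Variables (V : Type) (E : V -> V -> Prop).

Definition fin_set := list V.

Definition step (X : fin_set) (a b : V) : Prop :=
  E a b /\ ~ List.In a X /\ ~ List.In b X.

Definition reach (X : fin_set) : V -> V -> Prop := clos_refl_trans V (step X).

Definition strongly_conn (X : fin_set) (a b : V) : Prop :=
  ~ List.In a X /\ ~ List.In b X /\ reach X a b /\ reach X b a.

Definition solid : Prop :=
  forall X : fin_set, exists F : list V,
    forall v, ~ List.In v X -> exists c, List.In c F /\ strongly_conn X c v.

Definition is_ray (r : nat -> V) : Prop :=
  (forall i j, r i = r j -> i = j) /\ (forall i, E (r i) (r (S i))).

Definition solid_ray (r : nat -> V) : Prop :=
  is_ray r /\
  forall X : fin_set, exists n, forall i j, (n <= i)%nat -> (n <= j)%nat ->
    strongly_conn X (r i) (r j).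

Definition ray_equiv (r1 r2 : nat -> V) : Prop :=
  forall X : fin_set, exists n, forall i j, (n <= i)%nat -> (n <= j)%nat ->
    strongly_conn X (r1 i) (r2 j).

Definition is_end (w : (nat -> V) -> Prop) : Prop :=
  exists r, solid_ray r /\ forall r', w r' <-> (solid_ray r' /\ ray_equiv r r').

Definition End := { w : (nat -> V) -> Prop | is_end w }.

Definition CE (X : fin_set) (w : End) (v : V) : Prop :=
  ~ List.In v X /\
  exists r, proj1_sig w r /\ exists n, forall i, (n <= i)%nat -> strongly_conn X v (r i).

Definition separates (X : fin_set) (w1 w2 : End) : Prop :=
  ~ (forall v, CE X w1 v <-> CE X w2 v).

Inductive node : Type := NV (v : V) | NE (w : End).

(** a node is a vertex of, or an end living in, the component C (a set of
    vertices of D - X) *)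
Definition node_in (C : V -> Prop) (x : node) : Prop :=
  match x with
  | NV v => C v
  | NE w => exists r, proj1_sig w r /\ exists n, forall i, (n <= i)%nat -> C (r i)
  end.

Definition limit_edge (x y : node) : Prop :=
  match x, y with
  | NE w, NE h => w <> h /\
      forall X, separates X w h -> exists a b, CE X w a /\ CE X h b /\ E a b
  | NV v, NE w => forall X, ~ CE X w v -> exists b, CE X w b /\ E v b
  | NE w, NV v => forall X, ~ CE X w v -> exists a, CE X w a /\ E a v
  | NV _, NV _ => False
  end.

Definition is_edge (x y : node) : Prop :=
  match x, y with
  | NV v, NV w => E v w
  | _, _ => limit_edge x y
  end.

Definition edge := { p : node * node | is_edge p.1 p.2 }.
Definition etail (e : edge) : node := (proj1_sig e).1.
Definition ehead (e : edge) : node := (proj1_sig e).2.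

(** points of |D|: nodes, and inner points t in (0,1) of edges; the endpoints
    0 and 1 of [0,1]_e are identified with the tail and head nodes. *)
Inductive dpoint : Type :=
  | PN (x : node)
  | PI (e : edge) (t : R) (Ht : 0 < t < 1).

Definition star (v : V) (eps : R) : set dpoint :=
  fun p => match p with
  | PN x => x = NV v
  | PI e t _ => (etail e = NV v /\ t < eps) \/ (ehead e = NV v /\ 1 - eps < t)
  end.

Definition edge_interval (e : edge) (a b : R) : set dpoint :=
  fun p => match p with
  | PN _ => False
  | PI e' t _ => e' = e /\ a < t < b
  end.

Definition hatC (X : fin_set) (w : End) (eps : R) : set dpoint :=
  let C := CE X w in
  fun p => match p with
  | PN x => node_in C x
  | PI e t _ =>
      (node_in C (etail e) /\ node_in C (ehead e)) \/
      (node_in C (etail e) /\ ~ node_in C (ehead e) /\ t < eps) \/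
      (~ node_in C (etail e) /\ node_in C (ehead e) /\ 1 - eps < t)
  end.

Definition hatE (Tl Hd : node -> Prop) (z eps : R) : set dpoint :=
  fun p => match p with
  | PN _ => False
  | PI e t _ => Tl (etail e) /\ Hd (ehead e) /\ z - eps < t < z + eps
  end.

Inductive basic : set dpoint -> Prop :=
  | basic_star v eps :
      0 < eps < 1 -> basic (star v eps)
  | basic_edge (e : edge) (z a b : R) :
      (exists v w, etail e = NV v /\ ehead e = NV w) ->
      0 <= a -> a < z -> z < b -> b <= 1 ->
      basic (edge_interval e a b)
  | basic_end w X eps :
      0 < eps < 1 -> basic (hatC X w eps)
  | basic_limit_ends w h X z eps :
      limit_edge (NE w) (NE h) -> separates X w h ->
      0 < eps -> 0 < z - eps -> z + eps < 1 ->
      basic (hatE (node_in (CE X w)) (node_in (CE X h)) z eps)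
  | basic_limit_vend v w X z eps :
      limit_edge (NV v) (NE w) -> List.In v X ->
      0 < eps -> 0 < z - eps -> z + eps < 1 ->
      basic (hatE (fun x => x = NV v) (node_in (CE X w)) z eps)
  | basic_limit_endv w v X z eps :
      limit_edge (NE w) (NV v) -> List.In v X ->
      0 < eps -> 0 < z - eps -> z + eps < 1 ->
      basic (hatE (node_in (CE X w)) (fun x => x = NV v) z eps).

End DigraphSpace.

HB.instance Definition _ (V : Type) (E : V -> V -> Prop) :=
  gen_eqMixin (dpoint E).
HB.instance Definition _ (V : Type) (E : V -> V -> Prop) :=
  gen_choiceMixin (dpoint E).
HB.instance Definition _ (V : Type) (E : V -> V -> Prop) :=
  isSubBaseTopological.Build (dpoint E) (@basic V E) id.

(* Main.v *)
Require Import Defs.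
From Stdlib Require Import List Relations Reals Lra.
From mathcomp Require Import all_boot all_classical topology zify.

Set Implicit Arguments.
Unset Strict Implicit.
Unset Printing Implicit Defensive.

(** If infinitely many strong components of [D - X] exist, no finite family of
    basic sets covers [|D|], because every point has a basic neighbourhood
    whose vertices outside [X] lie in one strong component of [D - X].

    Conversely let [D] be solid and take an ultrafilter on [|D|]. Pushed forward
    along the tail map, it either concentrates on one vertex or selects, for
    every finite [X], one of the finitely many strong components [f X] of
    [D - X]; the same holds for heads. Such a coherent choice [f] (a direction)
    is induced by an end, so that tails and heads converge to nodes [x] and [y]
    while the coordinates converge to some [z] in [[0, 1]]; the limit is [x],
    [y] or the point [z] of the (limit) edge [xy].

    To find a ray for a direction [f], call [v] in-dominating if it reaches
    [f X] in [D - X] for all [X] not containing [v], and out-dominated in the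
    dual case. If some [f X0] contains no out-dominated (or no in-dominating)
    vertex, there is a sequence [X_n] with decreasing [f (X_n)] of empty
    intersection, and a ray may run through the sets [f (X_n)]. Otherwise a ray
    runs through infinitely many disjoint finite strongly connected subgraphs,
    each containing vertices of both kinds. *)

Local Open Scope classical_set_scope.
Local Open Scope nat_scope.

(** * Reachability and paths *)

Section Lists.
Variable V : Type.
Implicit Types (L : list V) (x y : V).

Lemma list_filter (P : V -> Prop) L :
  exists L', forall x, List.In x L' <-> List.In x L /\ P x.
Proof.
exists (List.filter (fun x => `[<P x>]) L) => x.
by rewrite List.filter_In; split=> -[? /asboolP].
Qed.

Lemma eventually_avoid (B : nat -> V -> Prop) L :
  (forall y, List.In y L -> exists N, forall k, N <= k -> ~ B k y) ->
  exists N, forall k, N <= k -> forall y, List.In y L -> ~ B k y.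
Proof.
elim: L => [|a L IH] hB; first by exists 0.
have [|N hN] := IH; first by move=> y Ly; apply: hB; right.
have [M hM] := hB a (or_introl erefl).
by exists (maxn N M) => k; rewrite geq_max => /andP[Nk Mk] y [<-|]; auto.
Qed.

Lemma list_choice (W : Type) (R : V -> list W -> Prop) L :
  (forall x, List.In x L -> exists Y, R x Y) ->
  exists Z : list W, forall x, List.In x L -> exists2 Y, R x Y & List.incl Y Z.
Proof.
elim: L => [|a L IH] hR; first by exists nil.
have [|Z hZ] := IH; first by move=> y Ly; apply: hR; right.
have [Y aY] := hR a (or_introl erefl).
exists (Y ++ Z) => x [<-|/hZ[Y' xY' Y'Z]].
  by exists Y => // y Yy; apply: List.in_or_app; left.
by exists Y' => // y /Y'Z Zy; apply: List.in_or_app; right.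
Qed.

Lemma list_in_cat (x : V) (L1 L2 : list V) :
  List.In x (L1 ++ L2) <-> List.In x L1 \/ List.In x L2.
Proof. exact: List.in_app_iff. Qed.

End Lists.

Section Reach.
Variables (V : Type) (E : V -> V -> Prop).
Implicit Types (X Y : fin_set V) (a b v x y : V) (L T : list V).

Lemma reach_trans X a b v : reach E X a b -> reach E X b v -> reach E X a v.
Proof. exact: rt_trans. Qed.

Lemma reach_sub X Y a b : List.incl X Y -> reach E Y a b -> reach E X a b.
Proof.
move=> XY; elim=> {a b} [a b [ab [aY bY]]|a|a y b _ ay _ yb].
- by apply: rt_step; split=> //; split=> /XY.
- exact: rt_refl.
- exact: reach_trans ay yb.
Qed.

Lemma reach_notin X a b : reach E X a b -> ~ List.In a X -> ~ List.In b X.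
Proof. by elim=> {a b} [a b [_ []]|//|a y b _ ay _ yb /ay /yb]. Qed.

Lemma reach_support X a b : ~ List.In a X -> reach E X a b ->
  exists L, [/\ List.In a L, List.In b L,
    forall x, List.In x L -> reach E X a x /\ reach E X x b &
    forall Y, (forall x, List.In x L -> ~ List.In x Y) -> reach E Y a b].
Proof.
move=> aX ab; have {}ab := clos_rt_rt1n _ _ _ _ ab; elim: ab aX => {a b} [a|a c b [ac [_ cX]] cb0 IH] aX.
  exists [:: a]; split=> [| |x [<-|[]]|Y _]; [by left|by left| |exact: rt_refl].
  by split; exact: rt_refl.
have cb := clos_rt1n_rt _ _ _ _ cb0; have sac : reach E X a c by apply: rt_step; split.
have [L [cL bL hL LY]] := IH cX.
exists (a :: L); split=> [| |x|Y aLY]; first by left.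
- by right.
- move=> [<-|/hL[cx xb]]; first by split; [exact: rt_refl|exact: reach_trans cb].
  by split=> //; exact: reach_trans cx.
- apply: (@reach_trans _ _ c); last by apply: LY => x Lx; apply: aLY; right.
  by apply: rt_step; split=> //; split; apply: aLY; [left|right].
Qed.

Lemma strongly_conn_refl X a : ~ List.In a X -> strongly_conn E X a a.
Proof. by move=> aX; split=> //; split=> //; split; exact: rt_refl. Qed.

Lemma strongly_conn_sym X a b : strongly_conn E X a b -> strongly_conn E X b a.
Proof. by move=> [? [? []]]. Qed.

Lemma strongly_conn_trans X a b v :
  strongly_conn E X a b -> strongly_conn E X b v -> strongly_conn E X a v.
Proof.
move=> [? [? [ab ba]]] [? [? [bv vb]]]; split=> //; split=> //.
by split; [exact: reach_trans bv|exact: reach_trans ba].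
Qed.

Lemma strongly_conn_sub X Y a b :
  List.incl X Y -> strongly_conn E Y a b -> strongly_conn E X a b.
Proof.
move=> XY [aY [bY [ab ba]]]; split; first by move/XY.
by split; [move/XY|split; exact: reach_sub XY _].
Qed.

Lemma strongly_conn_avoid X Y a b : strongly_conn E X a b ->
  (forall v, strongly_conn E X a v -> ~ List.In v Y) -> strongly_conn E Y a b.
Proof.
move=> [aX [bX [ab ba]]] hY.
have conn x : reach E X a x -> reach E X x a -> ~ List.In x Y.
  by move=> ax xa; apply: hY; have := reach_notin ax aX; do 2?split.
have [L [aL bL hL LY]] := reach_support aX ab.
have [M [_ _ hM MY]] := reach_support bX ba.
have LY' x : List.In x L -> ~ List.In x Y.
  by move=> /hL[ax xb]; apply: conn => //; exact: reach_trans ba.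
split; [exact: LY'|split; [exact: LY'|split; first exact: LY]].
by apply: MY => x /hM[bx xa]; apply: conn => //; exact: reach_trans bx.
Qed.

Fixpoint walk a T : Prop :=
  if T is b :: T' then E a b /\ walk b T' else True.

Lemma walk_suffix a T x : walk a T -> List.NoDup (a :: T) ->
  List.In x (a :: T) -> exists T', [/\ walk x T', List.NoDup (x :: T'),
    List.incl (x :: T') (a :: T) & last x T' = last a T].
Proof.
elim: T a => [|b T IH] a; first by move=> _ na [<-|[]]; exists nil; split.
move=> [ab bT] /[dup] nabT /List.NoDup_cons_iff[_ nbT] [<-|xT].
  by exists (b :: T); split=> //; exact: List.incl_refl.
have [T' [? ? xT' ?]] := IH b bT nbT xT.
by exists T'; split=> // y /xT'; right.
Qed.

Lemma first_hit X a b (S : V -> Prop) :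
  ~ List.In a X -> reach E X a b -> S b ->
  exists T, [/\ walk a T, List.NoDup (a :: T), S (last a T),
    forall x, List.In x (a :: T) -> ~ List.In x X &
    forall x, List.In x (a :: T) -> S x -> x = last a T].
Proof.
move=> aX ab; have {}ab := clos_rt_rt1n _ _ _ _ ab; elim: ab aX => {a b} [a|a c b [ac [_ cX]] _ IH] aX Sb.
  exists nil; split=> //=; [|by move=> x [<-|[]]|by move=> x [<-|[]]].
  by apply/List.NoDup_cons_iff; split=> //; constructor.
have [T [cT nT ST XT hT]] := IH cX Sb.
case: (pselect (S a)) => [Sa|nSa].
  exists nil; split=> //=; [|by move=> x [<-|[]]|by move=> x [<-|[]]].
  by apply/List.NoDup_cons_iff; split=> //; constructor.
case: (pselect (List.In a (c :: T))) => [aT|aT].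
  have [T' [aT' nT' iT' lT']] := walk_suffix cT nT aT.
  by exists T'; split; rewrite ?lT' // => x /iT'; auto.
exists (c :: T); split=> //; first exact/List.NoDup_cons_iff.
  by move=> x [<-|]; auto.
by move=> x [<-|] => [/nSa//|]; auto.
Qed.

End Reach.

Section SeqLists.
Variables (V : Type) (d : V).

Lemma in_nth (L : list V) i : i < size L -> List.In (nth d L i) L.
Proof. by elim: L i => [|a L IH] [|i] //= iL; [left|right; exact: IH]. Qed.

Lemma NoDup_nth_inj (L : list V) i j : List.NoDup L ->
  i < size L -> j < size L -> nth d L i = nth d L j -> i = j.
Proof.
elim: L i j => [|a L IH] [|i] [|j] //= /List.NoDup_cons_iff[aL nL] iL jL eij.
- by case: aL; rewrite eij; exact: in_nth.
- by case: aL; rewrite -eij; exact: in_nth.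
- by rewrite (IH i j).
Qed.

Lemma in_last (x : V) (s : list V) : List.In (last x s) (x :: s).
Proof. by elim: s x => [|b s IH] x /=; [left|right; exact: IH]. Qed.

Lemma in_belast (x y : V) (s : list V) : List.NoDup (x :: s) ->
  List.In y (belast x s) -> List.In y (x :: s) /\ y <> last x s.
Proof.
elim: s x => [|b s IH] x //= /List.NoDup_cons_iff[xbs nbs] [<-|/(IH _ nbs)[]].
  by split; [left|move=> xe; apply: xbs; rewrite xe; exact: in_last].
by split=> //; right.
Qed.

End SeqLists.

Lemma walk_nth (V : Type) (E : V -> V -> Prop) (d a : V) (T : list V) i :
  walk E a T -> i < size T -> E (nth d (a :: T) i) (nth d (a :: T) i.+1).
Proof.
by elim: T a i => [|b T IH] a [|i] //= [ab bT] iT //; exact: (IH b i).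
Qed.

Section RayOfSteps.
Variables (V : Type) (E : V -> V -> Prop) (state : Type).
Variables (used : state -> list V) (tip : state -> V).
Variables (good : state -> Prop) (R : state -> state -> Prop).

(** [used s] contains every vertex of the path built so far except its last
    vertex [tip s]; the path [T] prolongs it to the next tip. *)
Hypothesis step : forall s, good s -> exists s' T,
  [/\ good s' /\ R s s', walk E (tip s) T, List.NoDup (tip s :: T),
    last (tip s) T = tip s' /\ tip s' <> tip s &
    [/\ forall x, List.In x (tip s :: T) -> ~ List.In x (used s),
      List.incl (used s) (used s') &
      forall x, List.In x (tip s :: T) -> x <> tip s' -> List.In x (used s')]].

Lemma ray_of_steps s0 : good s0 -> exists (s : nat -> state) r t,
  [/\ is_ray E r, forall k, t k < t k.+1 &
    forall k, [/\ r (t k) = tip (s k), good (s k), R (s k) (s k.+1),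
      List.incl (used (s k)) (used (s k.+1)) &
      List.In (tip (s k)) (used (s k.+1))]].
Proof.
move=> g0.
have /choice[nx hnx] (s : state) : exists sT : state * list V, good s ->
  [/\ good sT.1 /\ R s sT.1, walk E (tip s) sT.2, List.NoDup (tip s :: sT.2),
    last (tip s) sT.2 = tip sT.1 /\ tip sT.1 <> tip s &
    [/\ forall x, List.In x (tip s :: sT.2) -> ~ List.In x (used s),
      List.incl (used s) (used sT.1) &
      forall x, List.In x (tip s :: sT.2) -> x <> tip sT.1 ->
        List.In x (used sT.1)]].
  case: (pselect (good s)) => [/step[s' [T h]]|ns]; first by exists (s', T).
  by exists (s, nil).
pose s k := iter k (fun s => (nx s).1) s0.
have gs k : good (s k) by elim: k => [//|k /hnx[[]]].
pose T k := (nx (s k)).2.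
pose L := fix L k := if k is k'.+1 then L k' ++ belast (tip (s k')) (T k') else [::].
have sS k : s k.+1 = (nx (s k)).1 by [].
have lT k : last (tip (s k)) (T k) = tip (s k.+1).
  by have [_ _ _ []] := hnx _ (gs k).
have LS k : L k.+1 ++ [:: tip (s k.+1)] = L k ++ tip (s k) :: T k.
  by rewrite /= -catA -(lT k) cats1 -lastI.
have Lused k : List.incl (L k) (used (s k)).
  elim: k => [|k IH] x //= /(List.in_app_or (L k))[/IH xL|].
    by have [_ _ _ _ [_ + _]] := hnx _ (gs k); apply.
  have [_ _ nT [eT _] [_ _ hT]] := hnx _ (gs k).
  by move=> /(in_belast nT)[xT]; rewrite eT; exact: hT.
have LND k : List.NoDup (L k ++ [:: tip (s k)]).
  elim: k => [|k IH]; first by repeat constructor.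
  rewrite LS; have [_ _ nT _ [dT _ _]] := hnx _ (gs k).
  apply: List.NoDup_app => //; first exact: List.NoDup_app_remove_r IH.
  by move=> x /Lused xs /dT.
have Lwalk k i : i.+1 < size (L k ++ [:: tip (s k)]) ->
  E (nth (tip s0) (L k ++ [:: tip (s k)]) i)
    (nth (tip s0) (L k ++ [:: tip (s k)]) i.+1).
  elim: k i => [|k IH] i //; rewrite LS size_cat /= => iL.
  have [_ wT _ _ _] := hnx _ (gs k).
  case: (ltnP i (size (L k))) => iLk.
    have := IH i; rewrite !size_cat /= => /(_ ltac:(lia)).
    rewrite !nth_cat iLk; case: ltnP => // ?.
    by have -> : i.+1 - size (L k) = 0 by lia.
  rewrite !nth_cat !ifF; [|lia..].
  by rewrite subSn//; apply: walk_nth => //; rewrite -/(T k); lia.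
have LT k : size (L k) < size (L k.+1).
  have [_ _ _ [eT ne] _] := hnx _ (gs k).
  have {ne}: T k <> [::] by move=> T0; move: eT ne; rewrite -/(T k) T0 /= => ->.
  by rewrite /= size_cat size_belast; case: (T k) => //= *; lia.
have Lpre k m : exists M, L (k + m) = L k ++ M.
  elim: m => [|m [M eM]]; first by exists nil; rewrite addn0 cats0.
  by exists (M ++ belast (tip (s (k + m))) (T (k + m))); rewrite addnS /= eM catA.
have Lnth k m i : i < size (L k) -> i < size (L m) ->
  nth (tip s0) (L k) i = nth (tip s0) (L m) i.
  wlog km : k m / k <= m => [H ik im|ik im].
    by case: (leqP k m) => [|/ltnW] km; [exact: H|symmetry; exact: H].
  by have [M] := Lpre k (m - k); rewrite subnKC// => ->; rewrite nth_cat ik.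
have Lsize k : k <= size (L k).
  by elim: k => [//|k IH]; exact: leq_ltn_trans (LT k).
pose r i := nth (tip s0) (L i.+1) i.
have rE k i : i < size (L k) -> r i = nth (tip s0) (L k) i.
  by move=> ik; apply: Lnth => //; exact: Lsize.
exists s, r, (fun k => size (L k)); split=> // [|k].
  split=> [i j|i].
    pose k := (maxn i j).+1; have kL := Lsize k.
    rewrite (rE k) ?(rE k); [|lia..].
    apply: NoDup_nth_inj; [|lia..].
    exact: List.NoDup_app_remove_r (LND k).
  have iL := Lsize i.+2; have := Lwalk i.+2 i.
  rewrite (rE i.+2 i) ?(rE i.+2 i.+1); [|lia..].
  move: (L i.+2) iL => l il; rewrite size_cat !nth_cat addn1 => /(_ ltac:(lia)).
  by rewrite !ifT //; lia.
have [[gk Rk] _ _ [eT ne] [_ iu hT]] := hnx _ (gs k).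
split=> //; last by apply: hT; [left|exact: nesym].
rewrite (rE k.+1)// /= nth_cat ltnn subnn.
by move: eT ne; rewrite -/(T k); case: (T k) => [/= -> []|].
Qed.

End RayOfSteps.

(** * Every direction has a ray *)

Section Reversal.
Variables (V : Type) (E : V -> V -> Prop).

Definition rev_rel : V -> V -> Prop := fun a b => E b a.

Lemma reach_rev X a b : reach E X a b -> reach rev_rel X b a.
Proof.
elim=> {a b} [a b [ab [aX bX]]|a|a y b _ ay _ yb]; last exact: rt_trans ay.
  by apply: rt_step; split.
exact: rt_refl.
Qed.

End Reversal.

Section Directions.
Variables (V : Type).

Definition direction (E : V -> V -> Prop) (f : fin_set V -> V -> Prop) :=
  [/\ forall X, exists v, f X v,
    forall X u v, f X u -> (f X v <-> strongly_conn E X u v) &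
    forall X Y v, List.incl X Y -> f Y v -> f X v].

Lemma direction_rev E f : direction E f -> direction (rev_rel E) f.
Proof.
move=> [f0 fC fS]; split=> // X u v fu; rewrite (fC _ _ _ fu).
by split=> -[? [? [? ?]]]; (split=> //; split=> //; split); exact: reach_rev.
Qed.

Definition in_dominates E (f : fin_set V -> V -> Prop) v :=
  forall X, ~ List.In v X -> exists2 u, f X u & reach E X v u.

Definition out_dominated E (f : fin_set V -> V -> Prop) v :=
  forall X, ~ List.In v X -> exists2 u, f X u & reach E X u v.

Variables (E : V -> V -> Prop) (f : fin_set V -> V -> Prop).
Hypothesis fdir : direction E f.
Implicit Types (X Y : fin_set V) (u v : V).

Lemma dir_notin X v : f X v -> ~ List.In v X.
Proof. by have [_ fC _] := fdir => fv; have [+ _] := fC _ _ v fv; case/(_ fv). Qed.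

Lemma dir_conn X u v : f X u -> f X v -> strongly_conn E X u v.
Proof. by have [_ fC _] := fdir => fu fv; apply/(fC _ _ _ fu). Qed.

Lemma dir_reach X u v : f X u -> f X v -> reach E X u v.
Proof. by move=> fu /(dir_conn fu)[_ [_ []]]. Qed.

Lemma dir_closed X u v w : f X u -> f X w -> reach E X u v -> reach E X v w ->
  f X v.
Proof.
have [_ fC _] := fdir => fu fw uv vw; apply/fC; first exact: fu.
have uX := dir_notin fu; split=> //; split; first exact: reach_notin uv uX.
by split=> //; apply: reach_trans vw _; exact: dir_reach.
Qed.

Lemma dir_avoid X Y v : (forall u, f X u -> ~ List.In u Y) -> f X v -> f Y v.
Proof.
have [f0 fC fS] := fdir => hY fv; have [w fw] := f0 (X ++ Y).
have fXw : f X w by apply: fS fw => x xX; apply: List.in_or_app; left.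
have fYw : f Y w by apply: fS fw => x xX; apply: List.in_or_app; right.
apply/fC; first exact: fYw.
apply: strongly_conn_avoid (dir_conn fXw fv) _ => u.
by move/(fC _ _ _ fXw); exact: hY.
Qed.

Section Sparse.
Variable X0 : fin_set V.
Hypothesis nodom : forall v, f X0 v -> ~ out_dominated E f v.

(* Vertices of [A] are put into the deleted set together with witnesses that
   they are not dominated; then no edge leads from the vertices reachable from
   [f Y] to [A], so that releasing [A] changes neither. *)
Lemma unreached_superset (A : list V) : (forall a, List.In a A -> f X0 a) ->
  exists X, [/\ List.incl X0 X, forall a, List.In a A -> ~ List.In a X &
    forall a u, List.In a A -> f X u -> ~ reach E X u a].
Proof.
have [f0 fC fS] := fdir => fA.
have [|Z hZ] := @list_choice V V
    (fun a X => ~ List.In a X /\ forall u, f X u -> ~ reach E X u a) A.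
  move=> a /fA /nodom /existsNP[X /not_implyP[aX hX]].
  by exists X; split=> // u fu ua; apply: hX; exists u.
pose Y := X0 ++ A ++ Z.
have [X hX] := list_filter (fun x => ~ List.In x A) Y.
have XY : List.incl X Y by move=> x /hX[].
have inY x : List.In x Y <-> [\/ List.In x X0, List.In x A | List.In x Z].
  split=> [/(List.in_app_or X0)[|/(List.in_app_or A)[]]|[]] h.
  - by constructor 1.
  - by constructor 2.
  - by constructor 3.
  - by apply: List.in_or_app; left.
  - by apply: List.in_or_app; right; apply: List.in_or_app; left.
  - by apply: List.in_or_app; right; apply: List.in_or_app; right.
have [w fw] := f0 Y; have fXw := fS _ _ _ XY fw.
have wY := dir_notin fw.
have stays x : reach E X w x -> reach E Y w x.
  move=> wx; have {}wx := clos_rt_rtn1 _ _ _ _ wx; elim: wx => {x} [|x y [xy [xX yX]] _ IH]; first exact: rt_refl.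
  have xY := reach_notin IH wY.
  have yY : ~ List.In y Y.
    move=> yY; have yA : List.In y A.
      by apply: contrapT => yA; apply: yX; apply/hX.
    have [B [yB /(_ w) hB] BZ] := hZ y yA.
    have BY : List.incl B Y by move=> b /BZ bZ; apply/inY; constructor 3.
    apply: hB; first exact: fS fw.
    apply: reach_trans (reach_sub BY IH) _; apply: rt_step; split=> //; split=> //.
    by move/BY.
  by apply: reach_trans IH _; apply: rt_step; split=> //; split.
exists X; split=> [x x0|a aA /hX[]//|a u aA fu ua].
  by apply/hX; split; [apply/inY; constructor 1|move=> /fA /dir_notin].
have wa : reach E Y w a by apply/stays/(reach_trans _ ua)/dir_reach.
by apply: (reach_notin wa wY); apply/inY; constructor 2.
Qed.

Lemma vanishing_sequence : exists Xs : nat -> fin_set V,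
  (forall n v, f (Xs n.+1) v -> f (Xs n) v) /\ forall v, exists n, ~ f (Xs n) v.
Proof.
have [f0 fC fS] := fdir.
have [c fc] := f0 X0.
have /choice[nx hnx] (A : list V) : exists X, (forall a, List.In a A -> f X0 a) ->
    [/\ List.incl X0 X, forall a, List.In a A -> ~ List.In a X &
      forall a u, List.In a A -> f X u -> ~ reach E X u a].
  case: (pselect (forall a, List.In a A -> f X0 a)) => [/unreached_superset[X ?]|?].
    by exists X.
  by exists nil.
have /choice[flt hflt] (X : list V) := list_filter (f X0) X.
pose A n := iter n (fun A => A ++ flt (nx A)) [:: c].
have fA n a : List.In a (A n) -> f X0 a.
  elim: n a => [|n IH] a /=; first by move=> [<-|[]].
  by move=> /(List.in_app_or (A n))[/IH|/hflt[]].
pose Xs n := nx (A n).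
have X0s n : List.incl X0 (Xs n) by have [] := hnx _ (fA n).
have AS n m : n <= m -> List.incl (A n) (A m).
  move=> /subnKC <-; elim: (m - n) => [|k IH]; first by rewrite addn0.
  by rewrite addnS /= => x /IH xA; apply: List.in_or_app; left.
have XA n m x : n < m -> f X0 x -> List.In x (Xs n) -> List.In x (A m).
  move=> nm fx xn; apply: AS nm _ _; apply: List.in_or_app; right.
  by apply/hflt.
have Xdisj n m x : n < m -> f X0 x -> List.In x (Xs n) -> ~ List.In x (Xs m).
  by move=> nm fx /(XA _ _ _ nm fx); have [_ h _] := hnx _ (fA m); exact: h.
exists Xs; split=> [n v|v].
  apply: dir_avoid => u fu un.
  have fu0 := fS _ _ _ (X0s _) fu.
  have [_ _ h] := hnx _ (fA n.+1); apply: (h u u) fu _; last exact: rt_refl.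
  exact: XA un.
apply: contrapT => /forallNP nv; have {}nv n : f (Xs n) v := contrapT (nv n).
have fv := fS _ _ _ (X0s 0) (nv 0).
have [L [_ _ hL LY]] := reach_support (dir_notin fv) (dir_reach fv fc).
have [y Ly|N hN] := @eventually_avoid V (fun n x => List.In x (Xs n)) L.
  have fy : f X0 y by have [vy yc] := hL y Ly; exact: dir_closed vy yc.
  case: (pselect (exists n, List.In y (Xs n))) => [[n yn]|ny].
    by exists n.+1 => k nk; exact: Xdisj yn.
  by exists 0 => k _ yk; apply: ny; exists k.
have [_ _ h] := hnx _ (fA N); apply: (h c v) => //.
- by apply: (AS 0) => //; left.
- exact: nv.
- by apply: LY => x /(hN _ (leqnn _)).
Qed.

End Sparse.

Lemma ray_of_vanishing (Xs : nat -> fin_set V) :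
  (forall n v, f (Xs n.+1) v -> f (Xs n) v) -> (forall v, exists n, ~ f (Xs n) v) ->
  exists r, is_ray E r /\ forall Y n, exists2 i, n <= i & f Y (r i).
Proof.
have [f0 fC fS] := fdir => dec van.
have decr n m v : n <= m -> f (Xs m) v -> f (Xs n) v.
  by move=> /subnKC <-; elim: (m - n) => [|k IH]; rewrite ?addn0// addnS => /dec.
have avoid L : exists N, forall n, N <= n -> forall x, List.In x L -> ~ f (Xs n) x.
  apply: (@eventually_avoid V (fun n x => f (Xs n) x)) => y _.
  by have [n ny] := van y; exists n => k nk /(decr _ _ _ nk).
pose good (s : list V * V * nat) :=
  f (Xs s.2) s.1.2 /\ forall x, List.In x s.1.1 -> ~ f (Xs s.2) x.
have [p fp] := f0 (Xs 0).
have [||s [r [t [rr tS hs]]]] := @ray_of_steps V E (list V * V * nat)%type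
    (fun s => s.1.1) (fun s => s.1.2) good (fun s s' => s.2 < s'.2) _ (nil, p, 0).
- move=> [[X q] m] [/= fq hX].
  have [N hN] := avoid (q :: X).
  pose m' := maxn N m.+1.
  have [b fb] := f0 (Xs m').
  have {}hN := hN m' (leq_maxl _ _).
  have qX : ~ List.In q X by move/hX.
  have mm' : m < m' by exact: leq_maxr.
  have fbm := decr _ _ _ (ltnW mm') fb.
  have qb : reach E X q b.
    have [L [_ _ hL]] := reach_support (dir_notin fq) (dir_reach fq fbm).
    by apply=> x /hL[qx xb] /hX; apply; exact: dir_closed qx xb.
  have [T [wT nT fT XT hT]] := first_hit qX qb fb.
  have [X' hX'] := list_filter (fun x => ~ f (Xs m') x) (X ++ q :: T).
  exists (X', last q T, m'), T; split=> //=.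
  - by split=> //; split=> // x /hX'[].
  - by split=> // lq; apply: (hN q); [left|rewrite -lq].
  - split=> // x h; [|move=> xl]; apply/hX'; split.
    + by apply: List.in_or_app; left.
    + by apply: hN; right.
    + by apply: List.in_or_app; right.
    + by move=> /(hT _ h).
- by split.
exists r; split=> // Y n.
have sk k : k <= (s k).2.
  elim: k => [//|k IH]; have [_ _ lt _ _] := hs k; exact: leq_ltn_trans IH lt.
have tk k : k <= t k by elim: k => [//|k IH]; exact: leq_ltn_trans IH (tS k).
have [N hN] := avoid Y.
pose k := maxn n N.
exists (t k); first exact: leq_trans (leq_maxl _ _) (tk k).
have [-> [fk _] _ _ _] := hs k.
apply: dir_avoid fk => u fu uY; apply: (hN (s k).2) uY fu.
exact: leq_trans (leq_maxr _ _) (sk k).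
Qed.

(* Each new tip dominates and lies in a finite strongly connected bead together
   with a dominated vertex; beads are pairwise disjoint, so a finite [Y] misses
   almost all of them, and a bead missing [Y] lies in [f Y]. *)
Lemma ray_of_beads :
  (forall X, exists2 v, f X v & in_dominates E f v) ->
  (forall X, exists2 v, f X v & out_dominated E f v) ->
  exists r, is_ray E r /\ forall Y n, exists2 i, n <= i & f Y (r i).
Proof.
have [f0 fC fS] := fdir => hI hO.
pose good (s : list V * V) := in_dominates E f s.2 /\ ~ List.In s.2 s.1.
pose bead (s s' : list V * V) (H : list V) :=
  [/\ List.incl H (s'.2 :: s'.1), forall x, List.In x H -> ~ List.In x (s.2 :: s.1)
    & forall Y, (forall x, List.In x H -> ~ List.In x Y) -> f Y s'.2].
have [p0 _ Ip0] := hI nil.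
have [||s [r [t [rr tS hs]]]] := @ray_of_steps V E (list V * V)%type fst snd good
    (fun s s' => exists H, bead s s' H) _ (nil, p0).
- move=> [X p] [/= Ip pX].
  have [i fi Ii] := hI (p :: X); have [o fo Oo] := hO (p :: X).
  have iX := dir_notin fi; have oX := dir_notin fo.
  have sX : List.incl X (p :: X) by move=> x; right.
  have pi : reach E X p i.
    have [u fu pu] := Ip X pX; apply: reach_trans pu _.
    exact: dir_reach fu (fS _ _ _ sX fi).
  have [T [wT nT lT XT hT]] := @first_hit V E X p i (fun x => x = i) pX pi erefl.
  have [L [iL oL hL LY]] := reach_support iX (dir_reach fi fo).
  have [M [oM iM hM MY]] := reach_support oX (dir_reach fo fi).
  have [X' hX'] := list_filter (fun x => x <> i) (X ++ (p :: T) ++ L ++ M).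
  have ip : i <> p by move=> ip; apply: iX; left.
  exists (X', i), T; split=> //=.
    split; first by split=> // /hX'[].
    exists (L ++ M); split=> /=.
    - move=> x xLM; case: (pselect (x = i)) => [->|xi]; first by left.
      by right; apply/hX'; split=> //; rewrite 2!list_in_cat; right; right.
    - by move=> x /(List.in_app_or L)[/hL[ix _]|/hM[ox _]];
        [exact: reach_notin ix iX|exact: reach_notin ox oX].
    - move=> Y hY.
      have io : reach E Y i o.
        by apply: LY => x xL; apply: hY; apply: List.in_or_app; left.
      have oi : reach E Y o i.
        by apply: MY => x xM; apply: hY; apply: List.in_or_app; right.
      have iY : ~ List.In i Y by apply: hY; apply: List.in_or_app; left.
      have oY : ~ List.In o Y by apply: hY; apply: List.in_or_app; left.
      have [u fu ou] := Oo Y oY; have [w fw wi] := Ii Y iY.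
      exact: dir_closed fu fw (reach_trans ou oi) wi.
  split=> // x h; [|move=> xi]; apply/hX'; split=> //.
  - by rewrite list_in_cat; left.
  - by move=> xi; apply: iX; right; rewrite -xi.
  - by rewrite 2!list_in_cat; right; left.
- by split.
exists r; split=> // Y n.
have /choice[H hH] k : exists H, bead (s k) (s k.+1) H by have [_ _ ? _ _] := hs k.
have tk k : k <= t k by elim: k => [//|k IH]; exact: leq_ltn_trans IH (tS k).
have mono k m : List.incl ((s k).2 :: (s k).1) ((s (k + m)).2 :: (s (k + m)).1).
  elim: m => [|m IH]; first by rewrite addn0; exact: List.incl_refl.
  rewrite addnS => x /IH xk; right.
  by have [_ _ _ iu it] := hs (k + m); case: xk => [<-|/iu].
have [y _|N hN] := @eventually_avoid V (fun k x => List.In x (H k)) Y.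
  case: (pselect (exists k, List.In y (H k))) => [[k yk]|ny].
    exists k.+1 => m km ym; have [yk' _ _] := hH k; have [_ ym' _] := hH m.
    by apply: (ym' y ym); rewrite -(subnKC km); apply: mono; exact: yk'.
  by exists 0 => k _ yk; apply: ny; exists k.
pose k := maxn n N.
exists (t k.+1).
  exact: leq_trans (leq_maxl _ _) (leq_trans (leqnSn _) (tk k.+1)).
have [-> _ _ _ _] := hs k.+1; have [_ _ ] := hH k; apply=> x xH xY.
exact: hN (leq_maxr n N) _ xY xH.
Qed.

End Directions.

Lemma ray_of_direction (V : Type) (E : V -> V -> Prop) f : direction E f ->
  exists r, is_ray E r /\ forall Y n, exists2 i, n <= i & f Y (r i).
Proof.
move=> fdir.
case: (pselect (forall X, exists2 v, f X v & out_dominated E f v)) => [hO|]; last first.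
  move=> /existsNP[X0 hX0].
  have [|Xs [dec van]] := vanishing_sequence fdir (X0 := X0).
    by move=> v fv Ov; apply: hX0; exists v.
  exact: ray_of_vanishing dec van.
case: (pselect (forall X, exists2 v, f X v & in_dominates E f v)) => [hI|].
  exact: ray_of_beads.
move=> /existsNP[X0 hX0].
have [|Xs [dec van]] := vanishing_sequence (direction_rev fdir) (X0 := X0).
  move=> v fv Ov; apply: hX0; exists v => // X /Ov[u fu uv]; exists u => //.
  exact: reach_rev uv.
exact: ray_of_vanishing dec van.
Qed.

(** * Ends and directions *)

Section Ends.
Variables (V : Type) (E : V -> V -> Prop).
Implicit Types (X Y : fin_set V) (w h : End E) (x : node E) (C : V -> Prop).

Lemma solid_ray_equiv (r : nat -> V) : solid_ray E r -> ray_equiv E r r.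
Proof. by case. Qed.

Lemma ray_equiv_sym (r r' : nat -> V) : ray_equiv E r r' -> ray_equiv E r' r.
Proof.
by move=> h X; have [n hn] := h X; exists n => i j ni nj; exact/strongly_conn_sym/hn.
Qed.

Lemma ray_equiv_trans (r r' r'' : nat -> V) :
  ray_equiv E r r' -> ray_equiv E r' r'' -> ray_equiv E r r''.
Proof.
move=> h h' X; have [n hn] := h X; have [m hm] := h' X.
exists (maxn n m) => i j; rewrite !geq_max => /andP[ni mi] /andP[nj mj].
exact: strongly_conn_trans (hn i i ni ni) (hm i j mi mj).
Qed.

Lemma end_ray w : exists2 r, proj1_sig w r & solid_ray E r.
Proof.
case: w => w [r [sr hr]] /=; exists r => //; apply/hr; split=> //.
exact: solid_ray_equiv.
Qed.

Lemma end_rays w r r' : proj1_sig w r -> proj1_sig w r' -> ray_equiv E r r'.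
Proof.
case: w => w [r0 [_ hr]] /= /hr[_ /ray_equiv_sym er] /hr[_ er'].
exact: ray_equiv_trans er er'.
Qed.

Lemma CE_tail w r X : proj1_sig w r -> exists n, forall i, n <= i -> CE X w (r i).
Proof.
move=> wr; have [n hn] := end_rays wr wr X.
exists n => i ni; split; first by have [] := hn i i ni ni.
by exists r; split=> //; exists n => j; exact: hn.
Qed.

Lemma CE_class w X u v : CE X w u -> (CE X w v <-> strongly_conn E X u v).
Proof.
move=> [uX [r [wr [n hn]]]]; split=> [[vX [r' [wr' [m hm]]]]|uv].
  have [k hk] := end_rays wr wr' X; pose j := maxn (maxn n m) k.
  apply: strongly_conn_trans (hn j _) _; first by lia.
  apply: strongly_conn_trans (hk j j _ _) _; [lia..|].
  by apply/strongly_conn_sym/hm; lia.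
split; first by have [_ []] := uv.
exists r; split=> //; exists n => i /hn; apply: strongly_conn_trans.
exact: strongly_conn_sym.
Qed.

Lemma CE_direction w : direction E (fun X => CE X w).
Proof.
split=> [X|X u v|X Y v XY].
- have [r wr _] := end_ray w; have [n hn] := CE_tail X wr.
  by exists (r n); exact: hn.
- exact: CE_class.
- move=> [vY [r [wr [n hn]]]]; split; first by move/XY.
  by exists r; split=> //; exists n => i /hn; exact: strongly_conn_sub.
Qed.

Lemma in_endP w r : proj1_sig w r <->
  solid_ray E r /\ forall X, exists n, forall i, n <= i -> CE X w (r i).
Proof.
split=> [wr|[sr hr]].
  split=> [|X]; last exact: CE_tail.
  by case: w wr => w [r0 [_ hr]] /= /hr[].
have [r0 wr0 sr0] := end_ray w.
have er : ray_equiv E r0 r.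
  move=> X; have [n hn] := hr X; have [m hm] := CE_tail X wr0.
  exists (maxn n m) => i j; rewrite !geq_max => /andP[ni mi] /andP[nj mj].
  by apply/(CE_class _ (hm i mi)); exact: hn.
case: w wr0 {hr} => w [r1 [_ hr1]] /= /hr1[_ er0]; apply/hr1; split=> //.
exact: ray_equiv_trans er0 er.
Qed.

Lemma end_ext w h : (forall X v, CE X w v <-> CE X h v) -> w = h.
Proof.
move=> wh; have : proj1_sig w = proj1_sig h.
  apply/funext => r; apply/propext.
  rewrite !in_endP; split=> -[sr hr]; split=> // X; have [n hn] := hr X;
    by exists n => i /hn /wh.
by case: w h {wh} => [w Pw] [h Ph] /= wh; exact: eq_exist.
Qed.

Lemma end_of_direction f : direction E f ->
  exists w, forall X v, CE X w v <-> f X v.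
Proof.
move=> fdir; have [f0 fC fS] := fdir.
have [r [rr fr]] := ray_of_direction fdir; have [rinj rE] := rr.
have tail X : exists n, forall i, n <= i -> f X (r i).
  have [y _|N hN] := @eventually_avoid V (fun i (v : V) => r i = v) X.
    case: (pselect (exists i, r i = y)) => [[i ri]|ny].
      by exists i.+1 => k ik rk; have := rinj i k; rewrite ri rk => /(_ erefl); lia.
    by exists 0 => k _ rk; apply: ny; exists k.
  have rX i : N <= i -> ~ List.In (r i) X by move=> /hN ri /ri.
  have reachr i k : N <= i -> reach E X (r i) (r (i + k)).
    move=> Ni; elim: k => [|k IH]; first by rewrite addn0; exact: rt_refl.
    rewrite addnS; apply: reach_trans IH _; apply: rt_step.
    by split=> //; split; apply: rX; lia.
  have [n Nn fn] := fr X N; exists n => i ni; have [j ij fj] := fr X i.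
  apply: (dir_closed fdir fn fj).
    by rewrite -(subnKC ni); exact: reachr.
  by rewrite -(subnKC ij); apply: reachr; lia.
have sr : solid_ray E r.
  split=> // X; have [n hn] := tail X; exists n => i j ni nj.
  by apply: (dir_conn fdir); exact: hn.
have wr : is_end E (fun r' => solid_ray E r' /\ ray_equiv E r r') by exists r.
exists (exist _ _ wr) => X v.
have [n hn] := tail X; have fv := hn n (leqnn n).
have wrr : proj1_sig (exist (is_end E) _ wr) r by split=> //; exact: solid_ray_equiv.
have [m hm] := CE_tail X wrr; pose k := maxn n m.
rewrite (CE_class _ (hm k _)); last by lia.
by rewrite -(fC X (r k) v) //; apply: hn; lia.
Qed.

Lemma node_in_sub C C' x : (forall v, C v -> C' v) -> node_in C x -> node_in C' x.
Proof.
move=> CC'; case: x => [v|w] /=; first exact: CC'.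
by move=> [r [wr [n hn]]]; exists r; split=> //; exists n => i /hn /CC'.
Qed.

Lemma node_in_strongly_conn X u v x :
  node_in (strongly_conn E X u) x -> node_in (strongly_conn E X v) x ->
  strongly_conn E X u v.
Proof.
case: x => [y|w] /=.
  by move=> uy vy; exact: strongly_conn_trans uy (strongly_conn_sym vy).
move=> [r [wr [n hn]]] [r' [wr' [m hm]]]; have [k hk] := end_rays wr wr' X.
pose j := maxn (maxn n m) k.
apply: strongly_conn_trans (hn j _) _; first by lia.
apply: strongly_conn_trans (hk j j _ _) _; [lia..|].
by apply/strongly_conn_sym/hm; lia.
Qed.

Lemma CE_strongly_conn X w u : CE X w u -> CE X w = strongly_conn E X u.
Proof. by move=> wu; apply/funext => v; apply/propext/CE_class. Qed.

Lemma CE_meet X w h x :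
  node_in (CE X w) x -> node_in (CE X h) x -> CE X w = CE X h.
Proof.
have [u wu] : exists u, CE X w u by have [+ _ _] := CE_direction w; apply.
have [v hv] : exists v, CE X h v by have [+ _ _] := CE_direction h; apply.
rewrite (CE_strongly_conn wu) (CE_strongly_conn hv) => nu nv.
rewrite -(CE_strongly_conn hv); apply/esym/CE_strongly_conn/(CE_class _ hv).
exact: node_in_strongly_conn nv nu.
Qed.

Lemma node_in_end X w : node_in (CE X w) (NE w).
Proof. by have [r wr _] := end_ray w; exists r; split=> //; exact: CE_tail. Qed.

End Ends.

Lemma basic_open (V : Type) (E : V -> V -> Prop) (B : set (dpoint E)) :
  basic B -> open B.
Proof.
move=> bB; exists [set B]; last by rewrite bigcup_set1.
by move=> _ ->; exact: finI_from1.
Qed.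

Lemma cvg_basic (V : Type) (E : V -> V -> Prop) (F : set_system (dpoint E))
    (FF : Filter F) (p : dpoint E) :
  (forall B, basic B -> B p -> F B) -> F --> p.
Proof.
move=> hF A; rewrite /= nbhsE => -[B [oB Bp] BA]; apply: filterS BA _.
have [D sD eB] := oB; move: Bp; rewrite -eB => -[C DC Cp].
apply: (filterS (P := C)); first by move=> q Cq; exists C.
have [S sS eC] := sD C DC; move: Cp; rewrite -eC => Cp.
apply: filter_bigI => B' SB'; apply: hF; last exact: Cp.
by have := sS B' SB'; rewrite inE.
Qed.

(** * Compactness *)

Section UltraLimits.
Local Open Scope R_scope.

Lemma ultra_list (T I : Type) (U : set_system T) (UU : UltraFilter U)
    (L : list I) (A : I -> set T) :
  U [set p | exists2 c, List.In c L & A c p] -> exists2 c, List.In c L & U (A c).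
Proof.
elim: L => [|c L IH] UL; first by have [p []] := filter_ex UL.
have [Uc|Uc] := in_ultra_setVsetC (A c) UU; first by exists c => //; left.
have [|d dL Ud] := IH; last by exists d => //; right.
by apply: filterS (filterI UL Uc) => p [[d [<-|dL] Ad] nc]; [case: nc|exists d].
Qed.

Lemma ultra_bounded_limit (T : Type) (U : set_system T) (UU : UltraFilter U)
    (g : T -> R) : (forall p, 0 <= g p <= 1) ->
  exists z, [/\ (0 <= z <= 1),
    forall b, (z < b) -> U [set p | (g p < b)] &
    forall a, (a < z) -> U [set p | (a < g p)]].
Proof.
move=> g01; pose S s := U [set p | (s <= g p)].
have S0 : S 0 by apply: filterS filterT => p _; case: (g01 p).
have Sb s : S s -> (s <= 1).
  by move=> Us; have [p /= sp] := filter_ex Us; have [_] := g01 p; lra.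
have [z [zub zlub]] := completeness S (ex_intro _ 1 Sb) (ex_intro _ 0 S0).
exists z; split=> [|b zb|a az].
- by split; [exact: zub|exact: zlub].
- have [Ub|] := in_ultra_setVsetC [set p | (b <= g p)] UU.
    by have := zub b Ub; lra.
  by apply: filterS => p /= ?; lra.
- apply: contrapT => nU; have : (z <= a); last by lra.
  apply: zlub => s Us; apply: contrapT => sa; apply: nU.
  by apply: filterS Us => p /= ?; lra.
Qed.

End UltraLimits.

Section Compactness.
Local Open Scope R_scope.
Variables (V : Type) (E : V -> V -> Prop).
Implicit Types (X Y : fin_set V) (w h : End E) (x y : node E) (e : edge E).

Definition node_cvg T (U : set_system T) (g : T -> node E) x :=
  (forall X w, U [set p | node_in (CE X w) (g p) <-> node_in (CE X w) x]) /\
  forall v, U [set p | g p = NV E v <-> x = NV E v].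

Lemma node_in_CE_iff X w h x y : node_in (CE X w) x -> node_in (CE X w) y ->
  node_in (CE X h) x <-> node_in (CE X h) y.
Proof.
by move=> wx wy; split=> [hx|hy];
  [rewrite -(CE_meet wx hx)|rewrite -(CE_meet wy hy)].
Qed.

Lemma node_cvg_ex T (U : set_system T) (UU : UltraFilter U) (g : T -> node E) :
  solid E -> exists x, node_cvg U g x.
Proof.
move=> solE.
case: (pselect (exists v, U [set p | g p = NV E v])) => [[v Uv]|nUv].
  by exists (NV E v); split=> *; apply: filterS Uv => p /= ->.
pose f X v := U [set p | node_in (strongly_conn E X v) (g p)].
have fdir : direction E f.
  split=> [X|X u v Uu|X Y v XY]; last first.
  - by apply: filterS => p /=; apply: node_in_sub => u; exact: strongly_conn_sub.
  - split=> [Uv|uv].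
      have [p [pu pv]] := filter_ex (filterI Uu Uv).
      exact: node_in_strongly_conn pu pv.
    apply: filterS Uu => p /=; apply: node_in_sub => a.
    exact/strongly_conn_trans/strongly_conn_sym.
  - have [F hF] := solE X.
    have [UX|UX] := in_ultra_setVsetC
        [set p | exists2 v : V, List.In v X & g p = NV E v] UU.
      have [v _ Uv] := @ultra_list _ _ _ _ X (fun v => [set p | g p = NV E v]) UX.
      by case: nUv; exists v.
    have [|c _ Uc] := @ultra_list _ _ U UU F
      (fun c => [set p | node_in (strongly_conn E X c) (g p)]); last by exists c.
    apply: filterS UX => p /= npX.
    case: (g p) npX => [v|w] npX.
      have [|c [cF cv]] := hF v; last by exists c.
      by move=> vX; apply: npX; exists v.
    have [r wr _] := end_ray w; have [n hn] := CE_tail X wr.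
    have [|c [cF cr]] := hF (r n); first by have [] := hn n (leqnn n).
    exists c => //; exists r; split=> //; exists n => i ni.
    apply: strongly_conn_trans cr _.
    by apply/(CE_class _ (hn n (leqnn n))); exact: hn.
have [w hw] := end_of_direction fdir.
have Uw X : U [set p | node_in (CE X w) (g p)].
  have [v fv] : exists v, f X v by have [+ _ _] := fdir; apply.
  by have /hw wv := fv; rewrite (CE_strongly_conn wv).
exists (NE w); split=> [X h|v].
  by apply: filterS (Uw X) => p /= pw; exact: node_in_CE_iff pw (node_in_end _ _).
apply: filterS (Uw [:: v]) => p /= pw; split=> // gv.
by move: pw; rewrite gv => -[vn _]; case: vn; left.
Qed.

Lemma edge_ext e e' : etail e = etail e' -> ehead e = ehead e' -> e = e'.
Proof.
case: e e' => [[x y] He] [[x' y'] He']; rewrite /etail /ehead /= => xx yy.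
by apply: eq_exist; rewrite xx yy.
Qed.

Lemma edge_from_vertex X v w e : etail e = NV E v -> node_in (CE X w) (ehead e) ->
  ~ CE X w v -> exists b, CE X w b /\ E v b.
Proof.
case: e => [[x [b|h]] He]; rewrite /etail /ehead /= => ex; move: He; rewrite {x}ex /=.
  by move=> vb wb _; exists b.
by move=> hlim /(CE_meet (node_in_end X h)) <-; exact: hlim.
Qed.

Lemma edge_to_vertex X v w e : ehead e = NV E v -> node_in (CE X w) (etail e) ->
  ~ CE X w v -> exists a, CE X w a /\ E a v.
Proof.
case: e => [[[b|h] x] He]; rewrite /etail /ehead /= => ex; move: He; rewrite {x}ex /=.
  by move=> vb wb _; exists b.
by move=> hlim /(CE_meet (node_in_end X h)) <-; exact: hlim.
Qed.

Lemma edge_between X w h e : node_in (CE X w) (etail e) ->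
  node_in (CE X h) (ehead e) -> separates X w h ->
  exists a b, CE X w a /\ CE X h b /\ E a b.
Proof.
move=> we he sep.
have disj v : CE X w v -> ~ CE X h v.
  move=> wv hv; apply: sep => u.
  by rewrite (@CE_meet _ _ X w h (NV E v) wv hv).
case et: (etail e) we => [a|w'] we.
  by have [|b [hb ab]] := edge_from_vertex et he; [exact: disj|exists a, b].
case eh: (ehead e) he => [b|h'] he.
  have [||a [wa ab]] := @edge_to_vertex X b w e eh; last by exists a, b.
    by rewrite et.
  by move/disj; exact.
have ew := CE_meet (node_in_end X w') we; have eh' := CE_meet (node_in_end X h') he.
have : is_edge (NE w') (NE h') by rewrite -et -eh; case: (e).
by rewrite -ew -eh'; case=> _; apply; rewrite /separates ew eh'.
Qed.

Definition tail_of (p : dpoint E) : node E :=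
  match p with PN x => x | Defs.PI e _ _ => etail e end.
Definition head_of (p : dpoint E) : node E :=
  match p with PN x => x | Defs.PI e _ _ => ehead e end.
Definition coord_of (p : dpoint E) : R :=
  match p with PN _ => 0 | Defs.PI _ t _ => t end.
Definition inner (p : dpoint E) : Prop :=
  match p with PN _ => False | Defs.PI _ _ _ => True end.

Lemma cvg_node (F : set_system (dpoint E)) (FF : Filter F) x :
  (forall v eps, 0 < eps < 1 -> x = NV E v -> F (star v eps)) ->
  (forall w X eps, 0 < eps < 1 -> node_in (CE X w) x -> F (hatC X w eps)) ->
  F --> PN x.
Proof. by move=> Fstar FhatC; apply: cvg_basic => B [] //=; auto. Qed.

Lemma ultra_cvg (U : set_system (dpoint E)) (UU : UltraFilter U) :
  solid E -> exists p : dpoint E, U --> p.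
Proof.
move=> solE.
have [x [xC xV]] := node_cvg_ex UU tail_of solE.
have [y [yC yV]] := node_cvg_ex UU head_of solE.
have [|z [z01 zlt zgt]] := @ultra_bounded_limit _ U UU coord_of.
  by move=> [? /=|e t /= ?]; lra.
have [Uin|Unode] := in_ultra_setVsetC inner UU; last first.
  exists (PN x); apply: cvg_node => [v eps _ xv|w X eps _ wx].
    apply: filterS (filterI Unode (xV v)) => -[q [_ qx]|e t Ht [[]]] //=.
    exact/qx.
  apply: filterS (filterI Unode (xC X w)) => -[q [_ qx]|e t Ht [[]]] //=.
  exact/qx.
have innerS (A B : set (dpoint E)) : U A ->
    (forall e t (Ht : 0 < t < 1), A (Defs.PI e Ht) -> B (Defs.PI e Ht)) -> U B.
  by move=> UA AB; apply: filterS (filterI Uin UA) => -[q [[]]|e t Ht [_ /AB]].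
case: (Req_dec z 0) => [z0|nz0].
  exists (PN x); apply: cvg_node => [v eps He xv|w X eps He wx].
    have {}zlt := zlt eps ltac:(lra).
    by apply: innerS (filterI zlt (xV v)) _ => e t Ht [te ev]; left; split=> //; exact/ev.
  have {}zlt := zlt eps ltac:(lra).
  apply: innerS (filterI zlt (xC X w)) _ => e t Ht [te [_ /(_ wx) we]].
  by case: (pselect (node_in (CE X w) (ehead e))); [left|right; left].
case: (Req_dec z 1) => [z1|nz1].
  exists (PN y); apply: cvg_node => [v eps He yv|w X eps He wy].
    have {}zgt := zgt (1 - eps) ltac:(lra).
    by apply: innerS (filterI zgt (yV v)) _ => e t Ht [te ev]; right; split=> //; exact/ev.
  have {}zgt := zgt (1 - eps) ltac:(lra).
  apply: innerS (filterI zgt (yC X w)) _ => e t Ht [te [_ /(_ wy) we]].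
  by case: (pselect (node_in (CE X w) (etail e))); [left|right; right].
have Hz : 0 < z < 1 by lra.
case: (pselect (exists2 w, x = NE w & y = NE w)) => [[w xw yw]|nxy].
  exists (PN (NE w)); apply: cvg_node => // h X eps He hw.
  apply: innerS (filterI (xC X h) (yC X h)) _ => e t Ht [ex ey].
  by left; split; [apply/ex|apply/ey]; rewrite ?xw ?yw.
have xyE : is_edge x y.
  have somewhere (A B : set (dpoint E)) : U A -> U B -> exists e t (Ht : 0 < t < 1),
      A (Defs.PI e Ht) /\ B (Defs.PI e Ht).
    move=> UA UB; have [[q|e t Ht] [qin AB]] := filter_ex (filterI Uin (filterI UA UB)) => //.
    by exists e, t, Ht.
  case ex: x => [v|w]; case ey: y => [u|h].
  - have [[[x' y'] exy] [t [Ht [tv hu]]]] := somewhere _ _ (xV v) (yV u).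
    have x'v : x' = NV E v by apply/tv.
    have y'u : y' = NV E u by apply/hu.
    by move: (exy); rewrite /= x'v y'u.
  - move=> X vh; have [e [t [Ht [tv hh]]]] := somewhere _ _ (xV v) (yC X h).
    apply: (@edge_from_vertex X v h e) => //; first exact/tv.
    by apply/hh; rewrite ey; exact: node_in_end.
  - move=> X uw; have [e [t [Ht [hu tw]]]] := somewhere _ _ (yV u) (xC X w).
    apply: (@edge_to_vertex X u w e) => //; first exact/hu.
    by apply/tw; rewrite ex; exact: node_in_end.
  - split=> [wh|X sep]; first by apply: nxy; exists w; rewrite // ey wh.
    have [e [t [Ht [tw hh]]]] := somewhere _ _ (xC X w) (yC X h).
    apply: (@edge_between X w h e) => //.
      by apply/tw; rewrite ex; exact: node_in_end.
    by apply/hh; rewrite ey; exact: node_in_end.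
pose e0 : edge E := exist _ (x, y) xyE.
have near a b : a < z < b -> U [set p | a < coord_of p < b].
  by move=> [az zb]; apply: filterS (filterI (zgt a az) (zlt b zb)) => p [].
exists (Defs.PI e0 Hz); apply: cvg_basic => B.
have hatE_near (Tl Hd : set (node E)) c eps : Tl x /\ Hd y /\ c - eps < z < c + eps ->
    (Tl x -> U [set p | Tl (tail_of p)]) -> (Hd y -> U [set p | Hd (head_of p)]) ->
    U (hatE Tl Hd c eps).
  move=> [Tx [Hy zc]] /(_ Tx) UT /(_ Hy) UH.
  by apply: innerS (filterI UT (filterI UH (near _ _ zc))) _ => e t Ht [? []].
have UV v : x = NV E v -> U [set p | tail_of p = NV E v].
  by move=> xv; apply: filterS (xV v) => p /= [_]; apply.
have UVy v : y = NV E v -> U [set p | head_of p = NV E v].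
  by move=> yv; apply: filterS (yV v) => p /= [_]; apply.
have UC X w : node_in (CE X w) x -> U [set p | node_in (CE X w) (tail_of p)].
  by move=> wx; apply: filterS (xC X w) => p /= [_]; apply.
have UCy X w : node_in (CE X w) y -> U [set p | node_in (CE X w) (head_of p)].
  by move=> wy; apply: filterS (yC X w) => p /= [_]; apply.
case=> {B} [v eps He|e c a b [v [u [ev eu]]] _ _ _ _|w X eps He|w h X c eps _ _ _ _ _
  |v w X c eps _ _ _ _ _|w v X c eps _ _ _ _ _] /=.
- rewrite /etail /ehead /= => -[[xv zeps]|[yv zeps]].
    by apply: innerS (filterI (UV v xv) (zlt _ zeps)) _ => e t Ht []; left.
  by apply: innerS (filterI (UVy v yv) (zgt _ zeps)) _ => e t Ht []; right.
- move=> [e0e zab]; have xv : x = NV E v by rewrite -ev -e0e.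
  have yu : y = NV E u by rewrite -eu -e0e.
  apply: innerS (filterI (near _ _ zab) (filterI (UV v xv) (UVy u yu))) _.
  move=> e' t Ht [tab [/= e'v e'u]]; split=> //.
  by apply: edge_ext; rewrite ?e'v ?e'u.
- rewrite /etail /ehead /= => -[[wx wy]|[[wx [wy zeps]]|[wx [wy zeps]]]].
  + by apply: innerS (filterI (UC X w wx) (UCy X w wy)) _ => e t Ht []; left.
  + apply: innerS (filterI (UC X w wx) (filterI (yC X w) (zlt _ zeps))) _.
    by move=> e t Ht [? [[hy _] ?]]; right; left; split=> //; split=> // /hy.
  + apply: innerS (filterI (UCy X w wy) (filterI (xC X w) (zgt _ zeps))) _.
    by move=> e t Ht [? [[hx _] ?]]; right; right; split=> // /hx.
- by move=> h0; apply: hatE_near => //; [exact: UC|exact: UCy].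
- by move=> h0; apply: hatE_near => //; [exact: UV|exact: UCy].
- by move=> h0; apply: hatE_near => //; [exact: UC|exact: UVy].
Qed.

Lemma solid_compact : solid E -> compact [set: dpoint E].
Proof.
move=> solE; rewrite compact_ultra => U UU _.
by have [p Up] := ultra_cvg UU solE; exists p.
Qed.

Lemma separate_nodes_of_component X (p : dpoint E) :
  exists2 B : set (dpoint E), basic B /\ B p &
    exists c : list V, forall v, ~ List.In v X -> B (PN (NV E v)) ->
      exists2 a, List.In a c & strongly_conn E X a v.
Proof.
have half : 0 < / 2 < 1 by lra.
have nonodes (B : set (dpoint E)) : basic B /\ B p ->
    (forall v, ~ B (PN (NV E v))) -> exists2 B : set (dpoint E), basic B /\ B p &
    exists c : list V, forall v, ~ List.In v X -> B (PN (NV E v)) ->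
      exists2 a, List.In a c & strongly_conn E X a v.
  by move=> bB nB; exists B => //; exists nil => v _ /nB.
case: p nonodes => [[v|w]|e t Ht] nonodes.
- exists (star v (/ 2)); first by split; [exact: basic_star|].
  exists [:: v] => u uX [eu]; exists v; first by left.
  by rewrite -eu; exact: strongly_conn_refl.
- exists (hatC X w (/ 2)); first by split; [exact: basic_end|exact: node_in_end].
  have [r wr _] := end_ray w; have [n hn] := CE_tail X wr.
  exists [:: r n] => u uX /= wu; exists (r n); first by left.
  by apply/(CE_class _ (hn n (leqnn n))).
- have he : is_edge (etail e) (ehead e) by case: (e).
  pose eps := Rmin t (1 - t) / 2.
  have [eps0 [epst eps1]] : 0 < eps /\ 0 < t - eps /\ t + eps < 1.
    have := Rmin_l t (1 - t); have := Rmin_r t (1 - t).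
    by have := Rmin_glb_lt t (1 - t) 0 ltac:(lra) ltac:(lra); rewrite /eps; lra.
  have teps : t - eps < t < t + eps by lra.
  case et: (etail e) he => [v|w] he; case eh: (ehead e) he => [u|h] he.
  + apply: (nonodes (edge_interval e 0 1) _ (fun _ => id)).
    by split=> //; apply: (@basic_edge _ _ e t); [exists v, u|lra..].
  + apply: (nonodes (hatE (fun x => x = NV E v) (node_in (CE [:: v] h)) t eps) _
      (fun _ => id)).
    split; first by apply: basic_limit_vend => //; left.
    by rewrite /= et eh; split=> //; split=> //; exact: node_in_end.
  + apply: (nonodes (hatE (node_in (CE [:: u] w)) (fun x => x = NV E u) t eps) _
      (fun _ => id)).
    split; first by apply: basic_limit_endv => //; left.
    by rewrite /= et eh; split=> //; exact: node_in_end.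
  + have [wh _] := he.
    have [Y sepY] : exists Y, separates Y w h.
      apply: contrapT => /forallNP nsep; apply: wh; apply: end_ext => Y v.
      by have /contrapT := nsep Y; apply.
    apply: (nonodes (hatE (node_in (CE Y w)) (node_in (CE Y h)) t eps) _ (fun _ => id)).
    split; first exact: basic_limit_ends.
    by rewrite /= et eh; split; [|split=> //]; exact: node_in_end.
Qed.

Lemma compact_solid : compact [set: dpoint E] -> solid E.
Proof.
move=> cE X; apply: contrapT => /forallNP nX.
pose rest (L : list V) : set (dpoint E) := [set p | exists v,
  [/\ p = PN (NV E v), ~ List.In v X &
    forall c, List.In c L -> ~ strongly_conn E X c v]].
pose G : set_system (dpoint E) := filter_from setT rest.
have GF : ProperFilter G.
  apply: filter_from_proper => [|L _].
    apply: filter_from_filter; first by exists nil.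
    move=> L M _ _; exists (L ++ M) => // p [v [-> vX hv]].
    by split; exists v; split=> // c cL; apply: hv; apply/list_in_cat; [left|right].
  have /existsNP[v /not_implyP[vX hv]] := nX L.
  by exists (PN (NV E v)), v; split=> // c cL cv; apply: hv; exists c.
have [p [_ clp]] := cE G GF filterT.
have [B [bB Bp] [L hL]] := separate_nodes_of_component X p.
have nB : nbhs p B by apply: open_nbhs_nbhs; split=> //; exact: basic_open.
have GL : G (rest L) by exists L.
have [q [[v [qv vX hv]] Bq]] := clp _ _ GL nB.
rewrite qv in Bq.
by have [c cL cv] := hL v vX Bq; exact: hv cL cv.
Qed.

End Compactness.

Theorem theorem1 (V : Type) (E : V -> V -> Prop) (Hloop : forall v, ~ E v v) :
  compact [set: dpoint E] <-> solid E.
Proof. by split; [exact: compact_solid|exact: solid_compact]. Qed.
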